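(* Let $B$ be any oriented graph that admits a homomorphism $B\to\vec K_2$. Then the underlying undirected graph $\overline{B}$ (with the bipartition induced by this homomorphism) has the asymmetric forcing property if and only if $B$ has the directed forcing property.
   Context: All graphs are finite with non-empty vertex set. An oriented graph is a directed graph obtained from a simple undirected graph by orienting each edge (so there are no loops and at most one of $(x,y),(y,x)$ is an edge). $v(G)$ and $e(G)$ denote the numbers of vertices and edges of $G$. $\vec K_2$ is the oriented graph with two vertices and a single directed edge. $\overline{B}$ denotes the undirected graph obtained from $B$ by forgetting the directions of all edges. A homomorphism of oriented graphs $f:V(B)\to V(G)$ is a map such that $(f(x),f(y))\in E(G)$ whenever $(x,y)\in E(B)$. The homomorphism density $t(B,G)$ is the number of homomorphisms from $B$ to $G$ divided by $v(G)^{v(B)}$; in particular $t(\vec K_2,G)=e(G)/v(G)^2$. A bipartite undirected graph always comes with a fixed ordered bipartition of its vertex set. If $A$ is bipartite with parts $A_1\sqcup A_2$ and $H$ is bipartite with non-empty parts $U_1\sqcup U_2$, then $t_{\mathrm{bip}}(A,H)$ is the fraction of maps $f:V(A)\to V(H)$ with $f(A_1)\subset U_1$ and $f(A_2)\subset U_2$ that are homomorphisms (send edges to edges). The bipartite density of $H$ is $t_{\mathrm{bip}}(K_2,H)=|E(H)|/(|U_1||U_2|)$. If $B$ has a homomorphism to $\vec K_2$, then $\overline{B}$ is regarded as a bipartite graph whose first part is the set of vertices mapped to the tail of the edge of $\vec K_2$ and whose second part is the set of vertices mapped to the head, so that all edges of $B$ are directed from the first part to the second. For a directed graph $G$ on vertex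 set $\{1,\dots,n\}$, the associated directed graphon $W_G:[0,1]^2\to[0,1]$ is obtained by partitioning $[0,1]$ into $n$ intervals $I_1,\dots,I_n$ of equal length and setting $W_G(x,y)=1$ if $x\in I_i$, $y\in I_j$ with $(i,j)\in E(G)$, and $0$ otherwise. For a bipartite graph $H$ with parts $\{v_1,\dots,v_n\}$ and $\{w_1,\dots,w_m\}$, the associated bipartite graphon $W_H:[0,1]^2\to[0,1]$ is obtained by partitioning $[0,1]$ into $n$ equal intervals $I_1,\dots,I_n$ and also into $m$ equal intervals $J_1,\dots,J_m$, and setting $W_H(x,y)=1$ if $x\in I_i$, $y\in J_j$ with $v_iw_j\in E(H)$, and $0$ otherwise. For a bounded measurable $U:[0,1]^2\to\mathbb{R}$, the cut norm is $\|U\|_\square=\sup_{S,T}\left|\int_{S\times T}U(x,y)\,dx\,dy\right|$, the supremum over measurable $S,T\subset[0,1]$. For $q\in[0,1]$, a sequence of directed graphs (respectively, bipartite graphs) $\{G_n\}_{n\in\mathbb{N}}$ is $q$-quasirandom if the associated directed (respectively, bipartite) graphons satisfy $\lim_{n\to\infty}\|W_{G_n}-q\|_\square=0$, where $q$ denotes the constant function. An oriented graph $B$ has the directed forcing property if for every $p\in[0,1]$ and every sequence of oriented graphs $\{G_n\}_{n\in\mathbb{N}}$ with $t(\vec K_2,G_n)\to p/2$ and $t(B,G_n)\to(p/2)^{e(B)}$ as $n\to\infty$, the sequence $\{G_n\}_{n\in\mathbb{N}}$ is $(p/2)$-quasirandom. A bipartite undirected graph $A$ has the asymmetric forcing property if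 for every $p\in[0,1]$ and every sequence of bipartite undirected graphs $\{H_n\}_{n\in\mathbb{N}}$ with $t_{\mathrm{bip}}(K_2,H_n)\to p$ and $t_{\mathrm{bip}}(A,H_n)\to p^{e(A)}$ as $n\to\infty$, the sequence $\{H_n\}_{n\in\mathbb{N}}$ is $p$-quasirandom. *)

(* Defs.v *)
From HB Require Import structures.
From mathcomp Require Import all_boot all_order all_algebra.
From mathcomp Require Import all_classical all_reals all_analysis.

Set Implicit Arguments.
Unset Strict Implicit.
Unset Printing Implicit Defensive.

Import Order.TTheory GRing.Theory Num.Theory.
Import numFieldNormedType.Exports.

Local Open Scope classical_set_scope.
Local Open Scope ring_scope.

Record digraph := Digraph {
  vertex :> finType;
  edge : rel vertex;
  vertex_gt0 : (0 < #|vertex|)%N }.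

(* Taking x = y in the second field excludes loops. *)
Record ograph := OGraph {
  ograph_digraph :> digraph;
  edge_asym : forall x y : ograph_digraph, edge x y -> ~~ edge y x }.

(* An undirected simple graph is a symmetric loopless digraph. *)
Record sgraph := SGraph {
  sgraph_digraph :> digraph;
  edge_sym : symmetric (@edge sgraph_digraph);
  edge_irr : irreflexive (@edge sgraph_digraph) }.

(* The ordered bipartition is (fst_part, ~: fst_part); either part may be
   empty. *)
Record bigraph := BiGraph {
  bigraph_sgraph :> sgraph;
  fst_part : {set bigraph_sgraph};
  edge_cross : forall x y : bigraph_sgraph,
    edge x y -> (x \in fst_part) != (y \in fst_part) }.

Definition snd_part (A : bigraph) : {set A} := ~: fst_part A.

Definition nonempty_parts (H : bigraph) : bool :=
  (fst_part H != finset.set0) && (snd_part H != finset.set0).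

Definition num_oedges (B : ograph) : nat :=
  #|[set e : B * B | edge e.1 e.2]%SET|.

(* Each undirected edge is counted once, as the unordered pair {x, y}. *)
Definition num_sedges (A : sgraph) : nat :=
  #|[set [set e.1; e.2] | e in [set e : A * A | edge e.1 e.2]]%SET|.

Definition is_hom (B G : digraph) (f : B -> G) : bool :=
  [forall x, forall y, edge x y ==> edge (f x) (f y)].

Definition hom_density (R : realType) (B G : digraph) : R :=
  #|[set f : {ffun B -> G} | is_hom f]%SET|%:R / (#|G| ^ #|B|)%:R.

Arguments hom_density : clear implicits.

Definition respects_parts (A H : bigraph) (f : A -> H) : bool :=
  [forall x, if x \in fst_part A then f x \in fst_part H
             else f x \in snd_part H].

(* Meaningful when both parts of H are non-empty, so that the denominator is
   non-zero. *)
Definition bip_density (R : realType) (A H : bigraph) : R :=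
  #|[set f : {ffun A -> H} | respects_parts f && is_hom f]%SET|%:R /
  #|[set f : {ffun A -> H} | respects_parts f]%SET|%:R.

Arguments bip_density : clear implicits.

Lemma bool_gt0 : (0 < #|{: bool}|)%N.
Proof. by rewrite card_bool. Qed.

(* vec K_2 : the only edge goes from the tail [false] to the head [true]. *)
Definition dK2_digraph : digraph :=
  @Digraph bool (fun x y => ~~ x && y) bool_gt0.

Lemma dK2_asym (x y : dK2_digraph) : edge x y -> ~~ edge y x.
Proof. by case: x; case: y. Qed.

Definition dK2 : ograph := OGraph dK2_asym.

Definition under_edge (B : digraph) : rel B := fun x y => edge x y || edge y x.

Definition under_digraph (B : ograph) : digraph :=
  @Digraph B (@under_edge B) (vertex_gt0 B).

Lemma under_sym (B : ograph) : symmetric (@edge (under_digraph B)).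
Proof. by move=> x y; rewrite /edge /= /under_edge orbC. Qed.

Lemma under_irr (B : ograph) : irreflexive (@edge (under_digraph B)).
Proof.
move=> x; rewrite /edge /= /under_edge orbb.
by apply/negP => xx; move: (edge_asym xx); rewrite xx.
Qed.

Definition under_sgraph (B : ograph) : sgraph :=
  SGraph (@under_sym B) (@under_irr B).

Definition tail_set (B : ograph) (h : B -> dK2) : {set under_sgraph B} :=
  [set x : B | h x == false]%SET.

Lemma under_cross (B : ograph) (h : B -> dK2) (hP : is_hom h)
    (x y : under_sgraph B) :
  edge x y -> (x \in tail_set h) != (y \in tail_set h).
Proof.
move=> xy; rewrite !inE.
have hE u v : @edge B u v -> edge (h u) (h v).
  by move: hP => /forallP/(_ u)/forallP/(_ v)/implyP.
by move: xy => /orP[] /hE; rewrite /edge /=; case: (h x); case: (h y).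
Qed.

Definition under_bigraph (B : ograph) (h : B -> dK2) (hP : is_hom h) :
  bigraph := BiGraph (under_cross hP).

Lemma id_hom (G : digraph) : is_hom (@id G).
Proof. by apply/forallP => x; apply/forallP => y; apply/implyP. Qed.

Definition K2 : bigraph := @under_bigraph dK2 id (id_hom dK2).

(* The i-th of n intervals of equal length partitioning [0, 1]: the last one is
   closed, the others are closed on the left and open on the right. *)
Definition part_itv (R : realType) (n : nat) (i : 'I_n) : interval R :=
  Interval (BLeft (i%:R / n%:R)) (BSide (i.+1 < n)%N (i.+1%:R / n%:R)).

Definition step_graphon (R : realType) (n m : nat) (E : 'I_n -> 'I_m -> bool)
    (x y : R) : R :=
  [exists i, exists j,
    [&& x \in part_itv R i, y \in part_itv R j & E i j]]%:R.

Definition digraphon (R : realType) (G : digraph) : R -> R -> R :=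
  step_graphon (fun i j : 'I_#|G| => edge (enum_val i) (enum_val j)).

Definition bigraphon (R : realType) (H : bigraph) : R -> R -> R :=
  step_graphon (fun (i : 'I_#|fst_part H|) (j : 'I_#|snd_part H|) =>
    edge (enum_val i) (enum_val j)).

Arguments digraphon : clear implicits.
Arguments bigraphon : clear implicits.

Definition cut_norm (R : realType) (U : R -> R -> R) : \bar R :=
  ereal_sup [set r | exists S T : set R,
    [/\ measurable S, measurable T, S `<=` `[0, 1], T `<=` `[0, 1] &
        r = (`| \int[(@lebesgue_measure R) \x (@lebesgue_measure R)]_(z in
               S `*` T) (U z.1 z.2)%:E |)%E]].

Definition quasirandom (R : realType) (q : R) (W : nat -> R -> R -> R) : Prop :=
  cut_norm (fun x y => W n x y - q) @[n --> \oo] --> 0%E.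

Definition directed_forcing (R : realType) (B : ograph) : Prop :=
  forall (p : R) (G : nat -> ograph), 0 <= p <= 1 ->
    hom_density R dK2 (G n) @[n --> \oo] --> p / 2 ->
    hom_density R B (G n) @[n --> \oo] --> (p / 2) ^+ num_oedges B ->
    quasirandom (p / 2) (fun n => digraphon R (G n)).

Definition asymmetric_forcing (R : realType) (A : bigraph) : Prop :=
  forall (p : R) (H : nat -> bigraph), 0 <= p <= 1 ->
    (forall n, nonempty_parts (H n)) ->
    bip_density R K2 (H n) @[n --> \oo] --> p ->
    bip_density R A (H n) @[n --> \oo] --> p ^+ num_sedges A ->
    quasirandom p (fun n => bigraphon R (H n)).

(* Main.v *)
Require Import Defs.
From mathcomp Require Import all_boot all_order all_algebra.
From mathcomp Require Import all_classical all_reals all_analysis.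
From mathcomp Require Import ring lra zify.

Set Implicit Arguments.
Unset Strict Implicit.
Unset Printing Implicit Defensive.

Import Order.TTheory GRing.Theory Num.Theory.
Import numFieldNormedType.Exports.

Local Open Scope classical_set_scope.
Local Open Scope ring_scope.

(** Directed from asymmetric: the bipartite double cover of an oriented graph
    [G] (two copies of the vertices, edges leading from the first to the second) has
    the same [B]-density, the same edge density and the same cut sums as [G].

    Asymmetric from directed: given [H] with parts [U1], [U2] and a tournament
    [T], orient the graph on [U1 * U2 * T] by [(a, b, i) -> (a', b', j)] iff
    [a ~ b'] in [H] and [i -> j] in [T].  A tail of [B] only sees its first
    coordinate and a head its second one, so densities factor exactly as
    [t(B, H) * t(B, T)], and the cut sums over sets pulled back from [U1] and
    [U2] are those of [H] times the edge density of [T].  It remains to choose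
    tournaments with [t(B, T) -> 2^-e(B)] and [t(K2, T) -> 1/2], which exist by
    the second moment method, the square of [t(B, T)] being the density of two
    disjoint copies of [B]. *)

(** * Cut norm of a step graphon *)

(** The cap at [n.-1] sends the right endpoint [x = 1] to the last interval, which is the closed
    one. *)
Definition itv_index (R : realType) (n : nat) (x : R) : nat :=
  minn (Num.truncn (x * n%:R)) n.-1.

Lemma itv_index_lt (R : realType) (n : nat) (x : R) :
  (0 < n)%N -> (itv_index n x < n)%N.
Proof. by rewrite /itv_index; lia. Qed.

Lemma mem_part_itv (R : realType) (n : nat) (i : 'I_n) (x : R) :
  0 <= x <= 1 -> (x \in part_itv R i) = (i == itv_index n x :> nat).
Proof.
move=> /andP[x0 x1]; have n0 : (0 < n)%N by apply: leq_ltn_trans (ltn_ord i).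
have nR : 0 < n%:R :> R by rewrite ltr0n.
have xn0 : 0 <= x * n%:R by rewrite mulr_ge0// ltW.
rewrite /part_itv in_itv /= /itv_index.
have iE : (i%:R / n%:R <= x) = (i <= Num.truncn (x * n%:R))%N.
  by rewrite ler_pdivrMr// -truncn_ge_nat.
rewrite iE; case: (ltnP i.+1 n) => ltin /=.
  rewrite ltr_pdivlMr// -truncn_le_nat -eqn_leq /minn.
  by case: ltnP => ?; apply/eqP/eqP; lia.
have iS : i.+1 = n by apply/eqP; rewrite eqn_leq ltin ltn_ord.
rewrite iS divff ?lt0r_neq0// x1 andbT /minn.
by case: ltnP => ?; apply/idP/eqP; lia.
Qed.

Lemma part_itv_sub01 (R : realType) (n : nat) (i : 'I_n) :
  [set` part_itv R i] `<=` `[0, 1].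
Proof.
have n0 : (0 < n)%N by apply: leq_ltn_trans (ltn_ord i).
have nR : 0 < n%:R :> R by rewrite ltr0n.
move=> x /=; rewrite /part_itv in_itv /= in_itv /= => /andP[ix xi].
rewrite (le_trans _ ix) ?divr_ge0//=.
have : x <= i.+1%:R / n%:R by move: xi; case: ltnP => //= _ /ltW.
by move=> /le_trans; apply; rewrite ler_pdivrMr// mul1r ler_nat.
Qed.

Lemma lebesgue_measure_part_itv (R : realType) (n : nat) (i : 'I_n) :
  @lebesgue_measure R [set` part_itv R i] = (n%:R^-1)%:E.
Proof.
have n0 : (0 < n)%N by apply: leq_ltn_trans (ltn_ord i).
have nR : 0 < n%:R :> R by rewrite ltr0n.
rewrite lebesgue_measure_itv /= lte_fin ltr_pM2r ?invr_gt0// ltr_nat ltnSn.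
by rewrite -EFinB -mulrBl -natr1 addrAC subrr add0r mul1r.
Qed.

(** Each point of the unit square lies in exactly one cell, so a single term of the double sum
    survives. Writing the step function as a combination of indicators makes it integrable by
    linearity. *)
Lemma step_graphonE (R : realType) (n m : nat) (E : 'I_n -> 'I_m -> bool)
    (q x y : R) : (0 < n)%N -> (0 < m)%N -> 0 <= x <= 1 -> 0 <= y <= 1 ->
  step_graphon E x y - q = \sum_i \sum_j ((E i j)%:R - q) *
    \1_([set` part_itv R i] `*` [set` part_itv R j]) (x, y).
Proof.
move=> n0 m0 x01 y01.
pose i0 := Ordinal (itv_index_lt x n0); pose j0 := Ordinal (itv_index_lt y m0).
have xE i : (x \in part_itv R i) = (i == i0) by rewrite mem_part_itv.
have yE j : (y \in part_itv R j) = (j == j0) by rewrite mem_part_itv.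
have iE i j : \1_([set` part_itv R i] `*` [set` part_itv R j]) (x, y) =
    ((i == i0) && (j == j0))%:R :> R.
  by rewrite indicE in_setX /= -xE -yE; congr ((_ && _)%:R);
    apply/idP/idP; rewrite inE.
apply/esym; rewrite (bigD1 i0)//= [X in _ + X]big1 ?addr0; last first.
  by move=> i /negPf ii0; rewrite big1// => j _; rewrite iE ii0 mulr0.
rewrite (bigD1 j0)//= [X in _ + X]big1 ?addr0; last first.
  by move=> j /negPf jj0; rewrite iE jj0 andbF mulr0.
rewrite iE !eqxx mulr1; congr (_%:R - _); congr nat_of_bool.
apply/esym; apply/existsP/idP => [[i /existsP[j]]|Eij].
  by rewrite xE yE => /and3P[/eqP-> /eqP->].
by exists i0; apply/existsP; exists j0; rewrite xE yE !eqxx.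
Qed.

Lemma integral_step_graphon (R : realType) (n m : nat)
    (E : 'I_n -> 'I_m -> bool) (q : R) (S T : set R) :
  (0 < n)%N -> (0 < m)%N -> measurable S -> measurable T ->
  S `<=` `[0, 1] -> T `<=` `[0, 1] ->
  (\int[(@lebesgue_measure R) \x (@lebesgue_measure R)]_(z in S `*` T)
     (step_graphon E z.1 z.2 - q)%:E)%E =
  (\sum_i \sum_j ((E i j)%:R - q) *
    (fine (lebesgue_measure (S `&` [set` part_itv R i])) *
     fine (lebesgue_measure (T `&` [set` part_itv R j]))))%:E.
Proof.
move=> n0 m0 mS mT S01 T01; set mu := (lebesgue_measure \x lebesgue_measure)%E.
have mST : measurable (S `*` T) by exact: measurableX.
have mI k (i : 'I_k) : measurable [set` part_itv R i].
  exact: measurable_itv.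
pose I (p : 'I_n * 'I_m) := [set` part_itv R p.1] `*` [set` part_itv R p.2].
have mIX p : measurable (I p) by exact: measurableX.
(* Finite measure makes the bounded indicators integrable, which linearity of the integral
   requires. *)
have muST : (mu (S `*` T) < +oo)%E.
  apply: (@le_lt_trans _ _ (mu (`[0, 1] `*` `[0, 1]))).
    apply: le_measure; rewrite ?inE//; first exact: measurableX.
    exact: setSX.
  rewrite /mu product_measure1E//.
  change (@lebesgue_measure R `[0%R, 1%R] *
          @lebesgue_measure R `[0%R, 1%R] < +oo)%E.
  by rewrite lebesgue_measure_itv/= lte01 -EFinB -EFinM ltry.
under eq_integral => z zST.
  have [zS zT] : S z.1 /\ T z.2 by move: zST; rewrite inE.
  rewrite step_graphonE//; [|by move: (S01 _ zS); rewrite /= in_itv|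
    by move: (T01 _ zT); rewrite /= in_itv].
  rewrite pair_big /= -sumEFin.
  under eq_bigr do rewrite EFinM -surjective_pairing.
  over.
have ig p : mu.-integrable (S `*` T) (fun z => (\1_(I p) z)%:E).
  apply: measurable_bounded_integrable => //.
    apply: measurable_realfun.measurable_indic; exact: mIX.
  exists 1; split => // M M1 z _ /=.
  by rewrite indicE normr_nat; apply: le_trans (ltW M1); rewrite lern1 leq_b1.
rewrite integral_sum//; last by move=> p; apply: integrableZl => //; exact: ig.
rewrite pair_big /= -sumEFin; apply: eq_bigr => p _.
rewrite integralZl //; last exact: ig.
rewrite EFinM integral_indic//; last exact: (mIX p).
congr (_ * _)%E.
have SE k (i : 'I_k) U : measurable U ->
    lebesgue_measure (U `&` [set` part_itv R i]) \is a fin_num.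
  move=> mU; rewrite ge0_fin_numE//.
  apply: (@le_lt_trans _ _ (lebesgue_measure [set` part_itv R i])).
    by apply: le_measure; rewrite ?inE//; exact: measurableI.
  by rewrite lebesgue_measure_part_itv ltry.
rewrite EFinM !fineK ?SE// -product_measure1E; [|exact: measurableI..].
by congr (mu _); rewrite setIC -setXI.
Qed.

(* A linear function on a cube is extremal at a vertex. *)
Lemma weighted_sum_le (R : realType) (I : finType) (w : R) (s c : I -> R) :
  (forall i, 0 <= s i <= w) ->
  exists P : pred I, `|\sum_i s i * c i| <= w * `|\sum_(i | P i) c i|.
Proof.
move=> sw; wlog S0 : c / 0 <= \sum_i s i * c i.
  move=> ih; have [/ih//|S0] := leP 0 (\sum_i s i * c i).
  have [|P] := ih (fun i => - c i).
    by under eq_bigr do rewrite mulrN; rewrite sumrN oppr_ge0 ltW.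
  under eq_bigr do rewrite mulrN; rewrite !sumrN !normrN => cP.
  by exists P.
(* With the sum non-negative, dropping the negative coefficients and giving the others the full
   weight [w] can only increase it. *)
exists (fun i => 0 <= c i).
rewrite (ger0_norm S0) ger0_norm; last exact: sumr_ge0.
rewrite mulr_sumr [leRHS]big_mkcond /=.
apply: ler_sum => i _; have /andP[s0 sw_i] := sw i.
have [c0|c0] := leP 0 (c i); first exact: ler_wpM2r.
by rewrite mulr_ge0_le0// ltW.
Qed.

(** * Cut sums as the discrete form of the cut norm *)

Definition cut_sum (R : realType) (V : finType) (A B : {pred V}) (E : rel V)
    (q : R) (P Q : pred V) : R :=
  \sum_(x in A | P x) \sum_(y in B | Q y) ((E x y)%:R - q).

(** Covers both kinds of graphon at once: [A] and [B] are the whole vertex set for [digraphon], and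
    the two parts for [bigraphon]. *)
Definition enum_graphon (R : realType) (V : finType) (A B : {pred V})
    (E : rel V) : R -> R -> R :=
  step_graphon (fun (i : 'I_#|A|) (j : 'I_#|B|) =>
    E (enum_val i) (enum_val j)).

Arguments enum_graphon R {V} A B E.

Lemma pred_enum_val (V : finType) (A : {pred V}) (P : pred 'I_#|A|) :
  exists P' : pred V, forall i, P' (enum_val i) = P i.
Proof.
exists (fun x => [exists i, P i && (enum_val i == x)]) => i.
apply/existsP/idP => [[j /andP[Pj /eqP/enum_val_inj <-]]//|Pi].
by exists i; rewrite Pi eqxx.
Qed.

Lemma cut_sum_enum (R : realType) (V : finType) (A B : {pred V}) (E : rel V)
    (q : R) (P Q : pred V) :
  cut_sum A B E q P Q =
  \sum_(i < #|A| | P (enum_val i)) \sum_(j < #|B| | Q (enum_val j))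
    ((E (enum_val i) (enum_val j))%:R - q).
Proof.
by rewrite /cut_sum big_enum_val_cond; apply: eq_bigr => i _;
  rewrite big_enum_val_cond.
Qed.

(** The integral over [S * T] is bilinear in the measures of [S] and [T] inside the intervals, and
    these measures are at most [1 / #|A|] and [1 / #|B|]. Applying [weighted_sum_le] in each
    variable replaces [S] and [T] by unions of whole intervals, that is, by sets of vertices. *)
Lemma cut_norm_enum_graphon_le (R : realType) (V : finType) (A B : {pred V})
    (E : rel V) (q c : R) : (0 < #|A|)%N -> (0 < #|B|)%N ->
  (forall P Q, `|cut_sum A B E q P Q| <= c * (#|A| * #|B|)%:R) ->
  (cut_norm (fun x y => enum_graphon R A B E x y - q)%R <= c%:E)%E.
Proof.
move=> A0 B0 cut; apply: ge_ereal_sup => _ [S [T [mS mT S01 T01 ->]]].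
rewrite integral_step_graphon// abse_EFin lee_fin.
have meas n (i : 'I_n) U : measurable U ->
    0 <= fine (@lebesgue_measure R (U `&` [set` part_itv R i])) <= n%:R^-1.
  move=> mU; rewrite fine_ge0//= -lee_fin -(lebesgue_measure_part_itv R i).
  have le : (@lebesgue_measure R (U `&` [set` part_itv R i]) <=
      @lebesgue_measure R [set` part_itv R i])%E.
    by apply: le_measure; rewrite ?inE//; exact: measurableI.
  by rewrite fineK// ge0_fin_numE// (le_lt_trans le)//
    lebesgue_measure_part_itv ltry.
set s := fun i : 'I_#|A| => fine (lebesgue_measure (S `&` [set` part_itv R i])).
set t := fun j : 'I_#|B| => fine (lebesgue_measure (T `&` [set` part_itv R j])).
set e := fun i j => (E (@enum_val V A i) (@enum_val V B j))%:R - q.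
rewrite (_ : \sum_i _ = \sum_i s i * \sum_j e i j * t j); last first.
  apply: eq_bigr => i _; rewrite mulr_sumr; apply: eq_bigr => j _.
  by rewrite mulrCA.
(* Round [S] with [T] kept fixed; [T] is rounded next, against the coefficients already summed over
   [P]. *)
have [P sP] := @weighted_sum_le R _ #|A|%:R^-1 s (fun i => \sum_j e i j * t j)
  (fun i => meas _ i _ mS).
apply: (le_trans sP); rewrite exchange_big /=.
have [Q tQ] := @weighted_sum_le R _ #|B|%:R^-1 t (fun j => \sum_(i | P i) e i j)
  (fun j => meas _ j _ mT).
under eq_bigr => j _ do rewrite -mulr_suml mulrC.
rewrite ler_pdivrMl ?ltr0n//; apply: (le_trans tQ).
rewrite ler_pdivrMl ?ltr0n// mulrCA mulrA -natrM mulrC.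
have [P' PE] := pred_enum_val P; have [Q' QE] := pred_enum_val Q.
apply: le_trans (cut P' Q'); rewrite cut_sum_enum exchange_big /=.
under eq_bigl do rewrite -PE.
by under [X in Num.norm X <= _]eq_bigr do under eq_bigl do rewrite -QE.
Qed.

(** The unions of the intervals indexed by [P] and by [Q] are admissible test sets, and the integral
    over their product is the normalised cut sum. *)
Lemma cut_norm_enum_graphon_ge (R : realType) (V : finType) (A B : {pred V})
    (E : rel V) (q : R) (P Q : pred V) : (0 < #|A|)%N -> (0 < #|B|)%N ->
  ((`|cut_sum A B E q P Q| / (#|A| * #|B|)%:R)%:E <=
  cut_norm (fun x y => enum_graphon R A B E x y - q)%R)%E.
Proof.
move=> A0 B0; apply: ereal_sup_ubound.
pose U (D : {pred V}) (X : pred V) : set R :=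
  \bigcup_(i in [set i : 'I_#|D| | X (enum_val i)]) [set` part_itv R i].
have mU D X : measurable (U D X).
  by apply: fin_bigcup_measurable => // i _; exact: measurable_itv.
have U01 D X : U D X `<=` `[0, 1].
  by apply: bigcup_sub => i _; exact: part_itv_sub01.
have UI D X (i : 'I_#|D|) :
    fine (lebesgue_measure (U D X `&` [set` part_itv R i])) =
    (X (enum_val i))%:R * #|D|%:R^-1.
  have [Xi|Xi] := boolP (X _).
    rewrite (_ : _ `&` _ = [set` part_itv R i]); last first.
      by apply/setIidPr => x xi; exists i.
    by rewrite lebesgue_measure_part_itv mul1r.
  rewrite (_ : _ `&` _ = set0) ?measure0 ?mul0r//.
  rewrite -subset0 => x [[j /= Xj xj] xi].
  have x01 : 0 <= x <= 1 by have := part_itv_sub01 xi; rewrite /= in_itv.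
  move: xi xj; rewrite /= !mem_part_itv// => /eqP <- /eqP/val_inj ji.
  by move: Xi; rewrite -ji Xj.
exists (U A P), (U B Q); split => //.
rewrite integral_step_graphon// abse_EFin; congr EFin.
rewrite -[X in _ / X]ger0_norm// -normf_div; congr Num.norm.
rewrite cut_sum_enum mulr_suml big_mkcond /=; apply: eq_bigr => i _.
under [RHS]eq_bigr do rewrite !UI.
case: (P _) => /=; last first.
  by rewrite big1// => j _; rewrite mul0r mul0r mulr0.
rewrite mulr_suml big_mkcond /=; apply: eq_bigr => j _.
case: (Q _) => /=; last by rewrite mul0r !mulr0.
by rewrite !mul1r natrM invfM.
Qed.

(** Combines the two bounds above. The cut norm is an extended real, so convergence to [0] includes
    being eventually finite, which is handled separately in both directions. *)
Lemma quasirandomP (R : realType) (q : R) (V : nat -> finType)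
    (A B : forall n, {pred V n}) (E : forall n, rel (V n)) :
  (forall n, (0 < #|A n|)%N) -> (forall n, (0 < #|B n|)%N) ->
  quasirandom q (fun n => enum_graphon R (A n) (B n) (E n)) <->
  forall eps, 0 < eps -> \forall n \near \oo, forall P Q,
    `|cut_sum (A n) (B n) (E n) q P Q| <= eps * (#|A n| * #|B n|)%:R.
Proof.
move=> A0 B0; have AB n : 0 < (#|A n| * #|B n|)%:R :> R.
  by rewrite ltr0n muln_gt0 A0 B0.
split.
  move=> /fine_cvgP[fin /cvgrPdist_le cut] eps eps0.
  near=> n => P Q; rewrite -ler_pdivrMr// -lee_fin.
  apply: le_trans (cut_norm_enum_graphon_ge _ _ _ _ _ _) _ => //.
  have cfin : cut_norm (fun x y => enum_graphon R (A n) (B n) (E n) x y - q)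
    \is a fin_num by near: n.
  rewrite -(fineK cfin) lee_fin; apply: le_trans (ler_norm _) _.
  by rewrite -normrN -sub0r; near: n; exact: cut.
move=> cut.
pose c n := cut_norm (fun x y => enum_graphon R (A n) (B n) (E n) x y - q).
change (c n @[n --> \oo] --> 0%E).
have c0 n : (0 <= c n)%E.
  apply: le_trans (cut_norm_enum_graphon_ge _ q xpredT xpredT (A0 n) (B0 n)).
  by rewrite lee_fin divr_ge0.
have cle eps : 0 < eps -> \forall n \near \oo, (c n <= eps%:E)%E.
  move=> eps0; apply: filterS (cut eps eps0) => n.
  exact: cut_norm_enum_graphon_le.
have cfin : \forall n \near \oo, c n \is a fin_num.
  apply: filterS (cle 1 ltr01) => n c1.
  by rewrite ge0_fin_numE// (le_lt_trans c1)// ltry.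
apply/fine_cvgP; split => //; apply/cvgrPdist_le => eps eps0.
near=> n; rewrite sub0r normrN ger0_norm /= ?fine_ge0// -lee_fin fineK.
  by near: n; exact: cle.
by near: n.
Unshelve. all: by end_near. Qed.

(** * Random tournaments *)

(** Injectivity of [g] on [D] means that the constraints concern distinct coordinates: each
    coordinate in the image of [D] has one admissible value, every other one has two. In
    probabilistic terms, [#|D|] independent fair bits take prescribed values with probability
    [2^-#|D|]. *)
Lemma card_ffun_constraints (I E : finType) (D : {set E}) (g : E -> I)
    (b : E -> bool) : {in D &, injective g} ->
  (#|[set s : {ffun I -> bool} | [forall e in D, s (g e) == b e]]%SET| *
   2 ^ #|D| = 2 ^ #|I|)%N.
Proof.
move=> ginj.
pose F i : pred bool := fun v => [forall e in D, (g e == i) ==> (v == b e)].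
have -> : #|[set s : {ffun I -> bool} | [forall e in D, s (g e) == b e]]%SET| =
    #|family F|.
  apply: eq_card => s; rewrite inE; apply/idP/familyP => [sb i|sF].
    apply/forallP => e; apply/implyP => eD; apply/implyP => /eqP <-.
    by move: sb => /forallP/(_ e)/implyP/(_ eD).
  apply/forallP => e; apply/implyP => eD.
  by have /forallP/(_ e) := sF (g e); rewrite eD eqxx.
rewrite card_family foldrE big_image /=.
have FE i : #|F i| = if i \in (g @: D)%SET then 1%N else 2%N.
  have [/imsetP[e eD ->]|iD] := boolP (i \in (g @: D)%SET).
    rewrite -(card1 (b e)); apply: eq_card => v; rewrite !inE.
    apply/forallP/eqP => [/(_ e)|-> e']; first by rewrite eD eqxx => /eqP.
    by apply/implyP => e'D; apply/implyP => /eqP/ginj ->.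
  rewrite -card_bool; apply: eq_card => v; rewrite !inE.
  apply/forallP => e; apply/implyP => eD; apply/implyP => /eqP ei.
  by case/negP: iD; rewrite -ei imset_f.
rewrite (eq_bigr _ (fun i _ => FE i)) (bigID [in (g @: D)%SET]) /=.
rewrite big1 => [|i ->//]; rewrite mul1n.
rewrite (eq_bigr (fun=> 2%N)) => [|i /negPf ->//].
rewrite (eq_bigl [in (~: (g @: D))%SET]) => [|i]; last by rewrite !inE.
by rewrite prod_nat_const -expnD -(card_in_imset ginj) addnC cardsC.
Qed.

(** The bit of [s] at [(i, j)] with [i < j] decides the direction between [i] and [j]. A uniform [s]
    in the full function space thus gives a uniformly random tournament. *)
Definition tournament_rel (k : nat) (s : {ffun 'I_k * 'I_k -> bool}) :
    rel 'I_k :=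
  fun i j => (i < j)%N && s (i, j) || (j < i)%N && ~~ s (j, i).

Lemma ordS_gt0 (k : nat) : (0 < #|{: 'I_k.+1}|)%N.
Proof. by rewrite card_ord. Qed.

Definition tournament_digraph (k : nat)
    (s : {ffun 'I_k.+1 * 'I_k.+1 -> bool}) : digraph :=
  @Digraph 'I_k.+1 (tournament_rel s) (ordS_gt0 k).

Lemma tournament_asym (k : nat) (s : {ffun 'I_k.+1 * 'I_k.+1 -> bool})
    (i j : tournament_digraph s) : edge i j -> ~~ edge j i.
Proof.
rewrite /edge /= /tournament_rel.
by case: (ltngtP i j) => //= _; case: (s _).
Qed.

Definition tournament (k : nat) (s : {ffun 'I_k.+1 * 'I_k.+1 -> bool}) :
  ograph := OGraph (@tournament_asym k s).

Lemma is_homP (B G : digraph) (f : B -> G) :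
  reflect (forall x y, edge x y -> edge (f x) (f y)) (is_hom f).
Proof.
apply: (iffP forallP) => [fP x y xy|fP x].
  by move: (fP x) => /forallP/(_ y)/implyP; apply.
by apply/forallP => y; apply/implyP; exact: fP.
Qed.

(** Under an injective [f], distinct edges of [D] land on distinct unordered pairs, so being a
    homomorphism prescribes exactly [num_oedges D] independent bits of [s]. *)
Lemma card_tournament_inj_hom (D : ograph) (k : nat) (f : D -> 'I_k.+1) :
  injective f ->
  (#|[set s | is_hom (f : D -> tournament s)]%SET| * 2 ^ num_oedges D =
   2 ^ (k.+1 * k.+1))%N.
Proof.
move=> finj; pose g (e : D * D) := if (f e.1 < f e.2)%N then (f e.1, f e.2)
  else (f e.2, f e.1).
pose b (e : D * D) := (f e.1 < f e.2)%N.
(* Here [g] gives the coordinate of [s] that governs the image of an edge, and [b] the value it must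
   take. A collision of [g] with the endpoints exchanged would make both [(x, y)] and [(y, x)] edges
   of [D]. *)
have ginj : {in [set e : D * D | edge e.1 e.2]%SET &, injective g}.
  move=> [x y] [x' y']; rewrite !inE /g /= => xy xy'.
  have := edge_asym xy; have := edge_asym xy'.
  by case: ifP => _; case: ifP => _ + + [] /finj e1 /finj e2; subst;
    rewrite ?xy ?xy'.
rewrite -[in RHS](card_ord k.+1) -card_prod -(card_ffun_constraints b ginj).
congr (_ * _)%N; apply: eq_card => s; rewrite !inE.
apply/is_homP/forallP => [sP [x y]|sP x y xy].
  apply/implyP; rewrite inE /= => /sP; rewrite /edge /= /tournament_rel /g /b /=.
  by case: ltngtP => //= _; case: (s _).
have := sP (x, y); rewrite inE xy /= /g /b /edge /= /tournament_rel.
case: ltngtP => //= [_ /eqP->//|_ /eqP->//|/val_inj/finj xE].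
by move: xy (edge_asym xy); rewrite xE => ->.
Qed.

Lemma hom_densityE (R : realType) (B G : digraph) :
  hom_density R B G = (\sum_(f : {ffun B -> G}) (is_hom f)%:R) /
                      (#|G| ^ #|B|)%:R.
Proof.
rewrite /hom_density -natr_sum -sum1_card big_mkcond /=; congr (_%:R / _).
by apply: eq_bigr => f _; rewrite inE; case: ifP.
Qed.

Lemma hom_density_ge0 (R : realType) (B G : digraph) : 0 <= hom_density R B G.
Proof. by rewrite divr_ge0. Qed.

(* Only the non-injective maps are not homomorphisms to a random tournament
   with probability exactly [2^-e]. *)
Lemma tournament_mean_dist (R : realType) (D : ograph) (k : nat) :
  `|(\sum_(s : {ffun 'I_k.+1 * 'I_k.+1 -> bool})
       hom_density R D (tournament s)) / (2 ^ (k.+1 * k.+1))%:R -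
    2^-1 ^+ num_oedges D| <= 1 - (k.+1 ^_ #|D|)%:R / (k.+1 ^ #|D|)%:R.
Proof.
set K := k.+1; set N := (2 ^ (K * K))%N.
have N0 : 0 < N%:R :> R by rewrite ltr0n expn_gt0.
have K0 : 0 < (K ^ #|D|)%:R :> R by rewrite ltr0n expn_gt0.
have cN : #|{ffun 'I_K * 'I_K -> bool}| = N.
  by rewrite card_ffun card_bool card_prod card_ord.
have cK : #|{ffun D -> 'I_K}| = (K ^ #|D|)%N by rewrite card_ffun card_ord.
(* The probability that the fixed map [f] is a homomorphism to a random tournament. The mean density
   is the average of [p f] over all maps [f]. *)
pose p (f : {ffun D -> 'I_K}) : R :=
  (\sum_s (is_hom (f : D -> tournament s))%:R) / N%:R.
have p01 f : 0 <= p f <= 1.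
  rewrite divr_ge0 ?sumr_ge0//= ler_pdivrMr// mul1r -natr_sum ler_nat -cN.
  by rewrite -sum1_card; apply: leq_sum => s _; exact: leq_b1.
have pinj (f : {ffun D -> 'I_K}) : injective f -> p f = 2^-1 ^+ num_oedges D.
  move=> /card_tournament_inj_hom /(congr1 (fun n => n%:R : R)) => E.
  apply: (mulIf (lt0r_neq0 N0)); rewrite divfK ?lt0r_neq0// -E natrM natrX.
  rewrite mulrCA -exprMn mulVf// expr1n mulr1 -sum1_card natr_sum [RHS]big_mkcond.
  by apply: eq_bigr => s _; rewrite inE; case: ifP.
have e01 : 0 <= (2^-1 : R) ^+ num_oedges D <= 1.
  by rewrite exprn_ge0//= exprn_ile1// invf_le1// ler1n.
have -> : (\sum_s hom_density R D (@tournament k s)) / N%:R =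
    (\sum_f p f) / (K ^ #|D|)%:R.
  under eq_bigr do rewrite hom_densityE /= card_ord.
  by rewrite -mulr_suml exchange_big /= mulrAC -mulr_suml.
have -> : (\sum_f p f) / (K ^ #|D|)%:R - 2^-1 ^+ num_oedges D =
    (\sum_f (p f - 2^-1 ^+ num_oedges D)) / (K ^ #|D|)%:R.
  rewrite sumrB sumr_const cK mulrBl -[in RHS](mulr_natr (_ ^+ _)).
  by rewrite mulfK// lt0r_neq0.
rewrite -[leRHS](mulfK (lt0r_neq0 K0)) normf_div (ger0_norm (ltW K0)).
rewrite ler_pM2r ?invr_gt0// mulrBl mul1r divfK ?lt0r_neq0//.
have <- : #|[set f : {ffun D -> 'I_K} | injectiveb f]%SET| = (K ^_ #|D|)%N.
  by rewrite card_inj_ffuns card_ord.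
apply: (le_trans (ler_norm_sum _ _ _)).
(* Injective maps contribute [0]. Any other map contributes at most [1], since [p f] and [2^-e] both
   lie in [[0, 1]]. *)
apply: (@le_trans _ _ (\sum_(f : {ffun D -> 'I_K}) (1 - (injectiveb f)%:R))).
  apply: ler_sum => f _; have [/injectiveP fi|_] := boolP (injectiveb f).
    by rewrite pinj// !subrr normr0.
  rewrite subr0 ler_norml; move: (p01 f) e01 => /andP[? ?] /andP[? ?].
  by apply/andP; split; lra.
rewrite sumrB sumr_const cK lerB//.
rewrite -sum1_card natr_sum big_mkcond; apply: ler_sum => f _.
by rewrite inE; case: ifP.
Qed.

(** The ratio is the proportion of injective maps from a [v]-element set, a product of a fixed
    number of factors [(k + 1 - j) / (k + 1)], each tending to [1]. *)
Lemma cvg_ffact_ratio (R : realType) (v : nat) :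
  ((k.+1 ^_ v)%:R / (k.+1 ^ v)%:R : R) @[k --> \oo] --> (1 : R).
Proof.
elim: v => [|v ih].
  by under eq_fun do rewrite divr1; exact: cvg_cst.
under eq_fun do rewrite ffactnSr expnSr !natrM -mulf_div.
suff hv : ((k.+1 - v)%:R / k.+1%:R : R) @[k --> \oo] --> (1 : R).
 have h1 : _ --> (1 * 1 : R) := cvgM ih hv.
  by rewrite mulr1 in h1; exact: h1.
(* The lower bound [1 - v / (k + 1)] stays valid where the natural subtraction truncates to [0]. *)
have h : (1 - v%:R * harmonic k : R) @[k --> \oo] --> (1 : R).
  have h1 : _ --> (1 - v%:R * 0 : R) :=
    cvgB (cvg_cst (1 : R)) (cvgM (cvg_cst (v%:R : R)) (@cvg_harmonic R)).
  by rewrite mulr0 subr0 in h1; exact: h1.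
apply: (@squeeze_cvgr _ _ _ R _ (fun=> 1) _ _ _ h); last exact: cvg_cst.
near=> k; have k0 : 0 < k.+1%:R :> R by rewrite ltr0n.
rewrite ler_pdivrMr// mul1r ler_nat leq_subr andbT /harmonic /=.
rewrite ler_pdivlMr// mulrBl mul1r divfK ?lt0r_neq0//.
rewrite lerBlDr -natrD ler_nat; lia.
Unshelve. all: by end_near. Qed.

Lemma cvg_tournament_mean (R : realType) (D : ograph) :
  (\sum_(s : {ffun 'I_k.+1 * 'I_k.+1 -> bool})
     hom_density R D (tournament s)) / (2 ^ (k.+1 * k.+1))%:R
  @[k --> \oo] --> (2^-1 ^+ num_oedges D : R).
Proof.
apply/cvgrPdist_le => eps eps0.
have /cvgrPdist_le/(_ _ eps0) := @cvg_ffact_ratio R #|D|.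
apply: filterS => k kle; rewrite distrC.
apply: le_trans (tournament_mean_dist _ _ _) _.
exact: le_trans (ler_norm _) kle.
Qed.

(** * Second moment method for tournaments *)

Lemma num_oedgesE (B : ograph) :
  num_oedges B = (\sum_(x : B) \sum_(y : B) edge x y)%N.
Proof.
rewrite /num_oedges -sum1_card big_mkcond pair_big /=.
by apply: eq_bigr => e _; rewrite inE; case: ifP.
Qed.

Lemma num_oedges_dK2 : num_oedges dK2 = 1%N.
Proof. by rewrite num_oedgesE !big_bool. Qed.

Section Duplicate.
Variable B : ograph.

Definition duplicate_rel : rel (B + B) := fun x y =>
  match x, y with
  | inl x, inl y => edge x y
  | inr x, inr y => edge x y
  | _, _ => false
  end.

Lemma duplicate_gt0 : (0 < #|{: B + B}|)%N.
Proof. by rewrite card_sum addn_gt0 vertex_gt0. Qed.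

Definition duplicate_digraph : digraph :=
  @Digraph (B + B)%type duplicate_rel duplicate_gt0.

Lemma duplicate_asym (x y : duplicate_digraph) : edge x y -> ~~ edge y x.
Proof. by case: x y => [] x [] y //; exact: edge_asym. Qed.

Definition duplicate : ograph := OGraph duplicate_asym.

Lemma num_oedges_duplicate : num_oedges duplicate = (2 * num_oedges B)%N.
Proof.
rewrite !num_oedgesE big_sumType /= mul2n -addnn.
by congr (_ + _)%N; apply: eq_bigr => x _; rewrite big_sumType /=;
  rewrite (big1 _ _ _ (fun _ _ => erefl)) ?addn0 ?add0n.
Qed.

(** A homomorphism from a disjoint union is a pair of homomorphisms. The second moment of the
    [B]-density is therefore the mean of the [duplicate]-density, whose limit is already known. *)
Lemma hom_density_duplicate (R : realType) (G : digraph) :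
  hom_density R duplicate G = hom_density R B G ^+ 2.
Proof.
rewrite !hom_densityE /= card_sum expnD natrM expr2 mulf_div; congr (_ / _).
pose F (p : {ffun B -> G} * {ffun B -> G}) : {ffun duplicate -> G} :=
  [ffun z : B + B => match z with inl x => p.1 x | inr x => p.2 x end].
pose F' (f : {ffun duplicate -> G}) : {ffun B -> G} * {ffun B -> G} :=
  ([ffun x => f (inl x)], [ffun x => f (inr x)]).
have FK : cancel F F'.
  by move=> [f g]; congr pair; apply/ffunP => x; rewrite !ffunE.
have F'K : cancel F' F.
  by move=> f; apply/ffunP => -[] x; rewrite !ffunE.
rewrite (reindex F) /=; last by exists F' => ? _; [exact: FK|exact: F'K].
rewrite mulr_suml; under [RHS]eq_bigr do rewrite mulr_sumr.
rewrite pair_big; apply: eq_bigr => -[f g] _ /=.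
rewrite -natrM mulnb; congr (nat_of_bool _)%:R.
apply/is_homP/andP => [fgP|[/is_homP fP /is_homP gP]].
  split; apply/is_homP => x y xy.
    by have := fgP (inl x) (inl y) xy; rewrite !ffunE.
  by have := fgP (inr x) (inr y) xy; rewrite !ffunE.
by move=> [] x [] y xy; rewrite !ffunE //; [exact: fP|exact: gP].
Qed.

End Duplicate.

Lemma exists_le_mean (R : realType) (I : finType) (i0 : I) (W : I -> R) :
  exists i, W i <= (\sum_j W j) / #|I|%:R.
Proof.
have I0 : (0 < #|I|)%N by apply/card_gt0P; exists i0.
case: (@arg_minP _ _ _ i0 xpredT W isT) => i _ iP; exists i.
rewrite ler_pdivlMr ?ltr0n// mulr_natr -sumr_const; apply: ler_sum => j _.
exact: iP.
Qed.

(** Let [c] be the limit of the mean. Expanding the square around [c] gives the mean for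
    [duplicate B], minus [2 c] times the mean for [B], plus [c^2]; this tends to
    [c^2 - 2 c^2 + c^2 = 0]. *)
Lemma cvg_tournament_variance (R : realType) (B : ograph) :
  (\sum_(s : {ffun 'I_k.+1 * 'I_k.+1 -> bool})
     (hom_density R B (tournament s) - 2^-1 ^+ num_oedges B) ^+ 2) /
     (2 ^ (k.+1 * k.+1))%:R @[k --> \oo] --> (0 : R).
Proof.
set c : R := 2^-1 ^+ num_oedges B.
have c2 : 2^-1 ^+ num_oedges (duplicate B) = c * c :> R.
  by rewrite num_oedges_duplicate mul2n -addnn exprD.
pose M (D : ograph) k : R := (\sum_(s : {ffun 'I_k.+1 * 'I_k.+1 -> bool})
  hom_density R D (tournament s)) / (2 ^ (k.+1 * k.+1))%:R.
have h : _ --> (2^-1 ^+ num_oedges (duplicate B) - 2 * c * c + c * c : R) :=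
  cvgD (cvgB (@cvg_tournament_mean R (duplicate B))
    (cvgM (cvg_cst (2 * c : R)) (@cvg_tournament_mean R B)))
    (cvg_cst (c * c : R)).
have c0 : c * c - 2 * c * c + c * c = 0 by ring.
rewrite c2 c0 in h.
rewrite (_ : (fun k => _) = (fun k => M (duplicate B) k - 2 * c * M B k + c * c)).
  exact: h.
apply/funext => k; rewrite /M.
set N := (2 ^ (k.+1 * k.+1))%N.
have N0 : N%:R != 0 :> R by rewrite pnatr_eq0 -lt0n expn_gt0.
have cN : #|{ffun 'I_k.+1 * 'I_k.+1 -> bool}| = N.
  by rewrite card_ffun card_bool card_prod card_ord.
rewrite [in RHS](eq_bigr _ (fun s _ => hom_density_duplicate B R (tournament s))).
rewrite -/c -[c * c](mulfK N0) mulrA -mulrBl -mulrDl; congr (_ / _).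
rewrite mulr_sumr -sumrB mulr_natr -cN -sumr_const -big_split /=.
by apply: eq_bigr => s _; ring.
Qed.

Lemma exists_quasirandom_tournaments (R : realType) (B : ograph) :
  exists T : nat -> ograph,
    hom_density R dK2 (T n) @[n --> \oo] --> (2^-1 : R) /\
    hom_density R B (T n) @[n --> \oo] --> (2^-1 ^+ num_oedges B : R).
Proof.
pose W (D : ograph) k (s : {ffun 'I_k.+1 * 'I_k.+1 -> bool}) : R :=
  (hom_density R D (tournament s) - 2^-1 ^+ num_oedges D) ^+ 2.
pose m k : R := (\sum_s W dK2 k s + \sum_s W B k s) / (2 ^ (k.+1 * k.+1))%:R.
have m0 : m k @[k --> \oo] --> (0 : R).
  have h : _ --> (0 + 0 : R) := cvgD (@cvg_tournament_variance R dK2)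
    (@cvg_tournament_variance R B).
  rewrite addr0 in h; rewrite (_ : m = (fun k => (\sum_s W dK2 k s) /
    (2 ^ (k.+1 * k.+1))%:R + (\sum_s W B k s) / (2 ^ (k.+1 * k.+1))%:R)).
    exact: h.
  by apply/funext => k; rewrite /m mulrDl.
(* One tournament must serve both densities, so it is chosen with the sum of the two squared
   deviations at most its mean. *)
have sP k : {s | W dK2 k s + W B k s <= m k}.
  apply/cid.
  have [s] := exists_le_mean [ffun=> true] (fun s => W dK2 k s + W B k s).
  rewrite big_split /= card_ffun card_bool card_prod card_ord => sP.
  by exists s.
have W0 D k s : 0 <= W D k s by exact: sqr_ge0.
have cvgW D : (forall k, W D k (sval (sP k)) <= m k) ->
    hom_density R D (tournament (sval (sP n))) @[n --> \oo] -->
    (2^-1 ^+ num_oedges D : R).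
  move=> Wm; apply/cvgrPdist_le => eps eps0.
  have /cvgrPdist_le/(_ (eps ^+ 2)) := m0; rewrite exprn_gt0// => /(_ isT).
  apply: filterS => k; rewrite sub0r normrN => /(le_trans (ler_norm _)).
  move=> /(le_trans (Wm k)); rewrite /W distrC -real_normK ?num_real//.
  by rewrite ler_pXn2r// nnegrE ltW.
exists (fun n => tournament (sval (sP n))); split.
  have := cvgW dK2; rewrite num_oedges_dK2 expr1; apply => k.
  by apply: le_trans (svalP (sP k)); rewrite lerDl.
by apply: cvgW => k; apply: le_trans (svalP (sP k)); rewrite lerDr.
Qed.

(** * Double cover and blow-up *)

Lemma hom_density_dK2 (R : realType) (G : digraph) :
  hom_density R dK2 G =
  (\sum_(x : G) \sum_(y : G) (edge x y)%:R) / (#|G| ^ 2)%:R.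
Proof.
rewrite hom_densityE /= card_bool; congr (_ / _).
pose F (p : G * G) : {ffun dK2 -> G} :=
  [ffun b : bool => if b then p.2 else p.1].
rewrite (reindex F); last first.
  exists (fun f : {ffun dK2 -> G} => (f false, f true)) => [[x y]|f] _.
    by rewrite !ffunE.
  by apply/(@ffunP dK2 (fun=> G)) => -[]; rewrite ffunE.
rewrite pair_big; apply: eq_bigr => -[x y] _ /=; congr (nat_of_bool _)%:R.
apply/is_homP/idP => [/(_ false true isT)|xy [] [] //]; rewrite !ffunE//.
Qed.

Lemma edge_hom_dK2 (B : ograph) (h : B -> dK2) (x y : B) : is_hom h ->
  edge x y -> h x = false /\ h y = true.
Proof.
by move=> /is_homP/[apply]; rewrite /edge /=; case: (h x); case: (h y).
Qed.

(** An unordered pair determines its edge in [B], because [h] tells the tail from the head. *)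
Lemma num_sedges_under (B : ograph) (h : B -> dK2) (hP : is_hom h) :
  num_sedges (under_bigraph hP) = num_oedges B.
Proof.
rewrite /num_sedges /num_oedges.
have pinj : {in [set e : B * B | edge e.1 e.2]%SET &,
    injective (fun e => [set e.1; e.2]%SET : {set B})}.
  move=> [x y] [x' y']; rewrite !inE /= => /(edge_hom_dK2 hP)[hx hy].
  move=> /(edge_hom_dK2 hP)[hx' hy'] E.
  have : x \in [set x'; y']%SET by rewrite -E !inE eqxx.
  have : y \in [set x'; y']%SET by rewrite -E !inE eqxx orbT.
  rewrite !inE => /orP[] /eqP yE /orP[] /eqP xE; subst => //; congruence.
rewrite -(card_in_imset pinj); apply: eq_card => s.
apply/imsetP/imsetP => -[[x y]]; rewrite inE /= => xy sE; last first.
  by exists (x, y) => //; rewrite inE /edge /= /under_edge xy.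
move: xy => /orP[] xy; first by exists (x, y); rewrite ?inE.
by exists (y, x); rewrite ?inE//= sE finset.setUC.
Qed.

Section DoubleCover.
Variable G : digraph.

Definition double_cover_rel : rel (G + G) := fun x y =>
  match x, y with
  | inl x, inr y => edge x y
  | inr y, inl x => edge x y
  | _, _ => false
  end.

Lemma double_cover_gt0 : (0 < #|{: G + G}|)%N.
Proof. by rewrite card_sum addn_gt0 vertex_gt0. Qed.

Definition double_cover_digraph : digraph :=
  @Digraph (G + G)%type double_cover_rel double_cover_gt0.

Lemma double_cover_sym : symmetric (@edge double_cover_digraph).
Proof. by case=> x []. Qed.

Lemma double_cover_irr : irreflexive (@edge double_cover_digraph).
Proof. by case. Qed.

Definition double_cover_sgraph : sgraph :=
  SGraph double_cover_sym double_cover_irr.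

Definition double_cover_fst : {set double_cover_sgraph} :=
  [set x : G + G | if x is inl _ then true else false]%SET.

Lemma double_cover_cross (x y : double_cover_sgraph) :
  edge x y -> (x \in double_cover_fst) != (y \in double_cover_fst).
Proof. by case: x y => [] x [] y //; rewrite !inE. Qed.

Definition double_cover : bigraph := BiGraph double_cover_cross.

Lemma card_double_cover_fst : #|fst_part double_cover| = #|G|.
Proof.
rewrite -sum1_card -[RHS]sum1_card big_mkcond big_sumType /=.
rewrite [X in (_ + X)%N]big1 => [|x _]; last by rewrite inE.
by rewrite addn0; apply: eq_bigr => x _; rewrite inE.
Qed.

Lemma card_double_cover_snd : #|snd_part double_cover| = #|G|.
Proof.
rewrite -sum1_card -[RHS]sum1_card big_mkcond big_sumType /=.
rewrite [X in (X + _)%N]big1 => [|x _]; last by rewrite !inE.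
by rewrite add0n; apply: eq_bigr => x _; rewrite !inE.
Qed.

Lemma double_cover_nonempty_parts : nonempty_parts double_cover.
Proof.
by rewrite /nonempty_parts -!card_gt0 card_double_cover_fst
  card_double_cover_snd vertex_gt0.
Qed.

(** A part-respecting map to the cover must send [x] to the copy dictated by [h x], so such maps
    correspond to arbitrary maps from [B] to [G], and homomorphisms to homomorphisms. *)
Lemma bip_density_double_cover (R : realType) (B : ograph) (h : B -> dK2)
    (hP : is_hom h) :
  bip_density R (under_bigraph hP) double_cover = hom_density R B G.
Proof.
pose F (f : {ffun B -> G}) : {ffun under_bigraph hP -> double_cover} :=
  [ffun x : B => if h x then inr (f x) else inl (f x)].
have Finj : injective F.
  move=> f g fg; apply/(@ffunP B (fun=> G)) => x.
  have := congr1 (fun f : {ffun under_bigraph hP -> double_cover} => f x) fg.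
  rewrite !ffunE.
  by case: ifP => _ [].
have Fresp f : respects_parts (F f).
  by apply/forallP => x; rewrite ffunE !inE; case: (h x).
have FP (f : {ffun under_bigraph hP -> double_cover}) : respects_parts f ->
    exists g, f = F g.
  move=> /forallP fP.
  exists [ffun x : B => match f x with inl y => y | inr y => y end].
  apply/(@ffunP (under_bigraph hP) (fun=> double_cover)) => x.
  rewrite !ffunE; move: (fP x); rewrite !inE.
  by case: (h x) => /=; case: (f x).
have Fhom f : is_hom (F f) = is_hom f.
  apply/is_homP/is_homP => [FfP x y xy|fP x y].
    have [hx hy] := edge_hom_dK2 hP xy.
    have : edge (F f x) (F f y) by apply: FfP; rewrite /edge /= /under_edge xy.
    by rewrite !ffunE hx hy.
  move=> /orP[] xy; have [hx hy] := edge_hom_dK2 hP xy;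
    by rewrite !ffunE hx hy; exact: fP.
rewrite /bip_density /hom_density; congr (_%:R / _%:R).
  rewrite -(card_imset _ Finj); apply: eq_card => f; rewrite inE.
  apply/andP/imsetP => [[/FP[g ->]]|[g + ->]]; last by rewrite inE Fhom.
  by rewrite Fhom => gP; exists g; rewrite ?inE.
rewrite -card_ffun -cardsT -(card_imset _ Finj); apply: eq_card => f.
rewrite inE; apply/idP/imsetP => [/FP[g ->]|[g _ -> //]].
by exists g; rewrite ?inE.
Qed.

Lemma cut_sum_double_cover (R : realType) (q : R) (P Q : pred G) :
  cut_sum G G (@edge G) q P Q =
  cut_sum (fst_part double_cover) (snd_part double_cover) (@edge double_cover) q
    (fun z => match z with inl x => P x | inr x => P x end)
    (fun z => match z with inl x => Q x | inr x => Q x end).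
Proof.
rewrite /cut_sum big_sumType /= [X in _ + X]big1 => [|x]; last first.
  by rewrite inE.
rewrite addr0; apply: eq_big => [x|x _]; first by rewrite inE.
rewrite big_sumType /= [X in X + _]big1 => [|y]; last by rewrite !inE.
by rewrite add0r; apply: eq_bigl => y; rewrite !inE.
Qed.

End DoubleCover.

Section Blowup.
Variables (H : bigraph) (T : ograph).
Hypothesis H0 : nonempty_parts H.

Local Notation U1 := {x : H | x \in fst_part H}.
Local Notation U2 := {x : H | x \in snd_part H}.

(** Adjacency in [H] alone could hold in both directions between two vertices; the factor [T] keeps
    at most one of them and makes the graph oriented. *)
Definition blowup_rel : rel (U1 * U2 * T) := fun v w =>
  edge (val v.1.1) (val w.1.2) && edge v.2 w.2.

Lemma blowup_gt0 : (0 < #|{: U1 * U2 * T}|)%N.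
Proof.
move: H0; rewrite /nonempty_parts -!card_gt0 => /andP[n0 m0].
by rewrite !card_prod !card_sig !muln_gt0 n0 m0 vertex_gt0.
Qed.

Definition blowup_digraph : digraph :=
  @Digraph (U1 * U2 * T)%type blowup_rel blowup_gt0.

Lemma blowup_asym (v w : blowup_digraph) : edge v w -> ~~ edge w v.
Proof.
move=> /andP[_ vw]; apply/negP => /andP[_ wv].
by move: (edge_asym vw); rewrite wv.
Qed.

Definition blowup : ograph := OGraph blowup_asym.

Lemma card_blowup : #|blowup| = (#|fst_part H| * #|snd_part H| * #|T|)%N.
Proof. by rewrite !card_prod !card_sig. Qed.

(** Whether a map from [B] is a homomorphism depends only on the coordinates that the edges see: a
    part-respecting map to [H] and a map to [T]. Every such pair arises from the same number [K] of
    maps, so the uniform measure projects to a product of uniform measures. *)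
Lemma hom_density_blowup (R : realType) (B : ograph) (h : B -> dK2)
    (hP : is_hom h) :
  hom_density R B blowup =
  bip_density R (under_bigraph hP) H * hom_density R B T.
Proof.
set A := under_bigraph hP.
pose proj (f : {ffun B -> blowup}) : {ffun A -> H} * {ffun B -> T} :=
  ([ffun x : B => if h x then val (f x).1.2 else val (f x).1.1],
   [ffun x => (f x).2]).
have proj_resp f : respects_parts (proj f).1.
  apply/forallP => x; rewrite ffunE !inE.
  by case: (h x) => /=; [have := valP (f x).1.2|have := valP (f x).1.1];
    rewrite ?inE.
have proj_hom (f : {ffun B -> blowup}) :
    is_hom f = is_hom (proj f).1 && is_hom (proj f).2.
  apply/is_homP/andP => [fP|[/is_homP gP /is_homP iP] x y xy].
    split; apply/is_homP => x y; last by move=> /fP/andP[]; rewrite !ffunE.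
    move=> /orP[] xy; have [hx hy] := edge_hom_dK2 hP xy;
      have /andP[+ _] := fP _ _ xy; rewrite !ffunE hx hy //.
    by rewrite edge_sym.
  have [hx hy] := edge_hom_dK2 hP xy.
  have := iP _ _ xy; have : edge ((proj f).1 x) ((proj f).1 y).
    by apply: gP; rewrite /edge /= /under_edge xy.
  by rewrite !ffunE hx hy => gxy ixy; exact/andP.
(* Counts the free choices of the unseen coordinate: in the first part of [H] for a head, in the
   second for a tail. *)
pose K := (\prod_(x : B) if h x then #|fst_part H| else #|snd_part H|)%N.
have fiber (p : {ffun A -> H} * {ffun B -> T}) : respects_parts p.1 ->
    #|[set f | proj f == p]%SET| = K.
  case: p => g i /= gP.
  pose F (x : B) : pred blowup := fun v =>
    ((if h x then val v.1.2 else val v.1.1) == g x) && (v.2 == i x).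
  have -> : #|[set f | proj f == (g, i)]%SET| = #|family F|.
    apply: eq_card => f; rewrite inE; apply/eqP/familyP => [[gE iE] x|fF].
      by rewrite /in_mem /= /F -gE -iE !ffunE !eqxx.
    by congr pair; apply/ffunP => x; have /andP[/eqP gE /eqP iE] := fF x;
      rewrite ffunE.
  rewrite card_family foldrE big_image; apply: eq_bigr => x _.
  move/forallP/(_ x): gP; rewrite !inE; rewrite /F; case: (h x) => /= gx.
    have gx' : g x \in snd_part H by rewrite inE.
    pose f (a : U1) : blowup := (a, Sub (g x) gx', i x).
    have finj : injective f by move=> a a' [].
    rewrite -[RHS]card_sig -cardsT -(card_imset _ finj).
    apply: eq_card => -[[a b] j]; apply/andP/imsetP => /= [[/eqP bg /eqP ->]|].
      by exists a => //; congr (_, _, _); exact: val_inj.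
    by case=> a' _ [_ -> ->]; rewrite SubK !eqxx.
  pose f (b : U2) : blowup := (Sub (g x) gx, b, i x).
  have finj : injective f by move=> b b' [].
  rewrite -[RHS]card_sig -cardsT -(card_imset _ finj).
  apply: eq_card => -[[a b] j]; apply/andP/imsetP => /= [[/eqP ag /eqP ->]|].
    by exists b => //; congr (_, _, _); exact: val_inj.
  by case=> b' _ [-> _ ->]; rewrite SubK !eqxx.
pose r (p : {ffun A -> H} * {ffun B -> T}) := respects_parts p.1.
have sum_proj (F : {ffun A -> H} * {ffun B -> T} -> R) :
    \sum_(f : {ffun B -> blowup}) F (proj f) = K%:R * \sum_p (r p)%:R * F p.
  rewrite (partition_big proj xpredT)//= mulr_sumr; apply: eq_bigr => p _.
  rewrite (eq_bigr (fun=> F p)) => [|f /eqP ->//].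
  rewrite sumr_const; have [pP|pP] := boolP (r p).
    rewrite mul1r mulr_natl -(fiber p pP); congr (_ *+ _).
    by apply: eq_card => f; rewrite inE.
  rewrite mul0r mulr0 (_ : #|_| = 0%N)//; apply: eq_card0 => f.
  apply/negbTE; apply: contraNN pP => fp.
  have <- : proj f = p by apply/eqP; exact: fp.
  exact: proj_resp.
have sum_split (a : pred {ffun A -> H}) (b : pred {ffun B -> T}) :
    \sum_p (a p.1 && b p.2)%:R =
    #|[set g | a g]%SET|%:R * #|[set i | b i]%SET|%:R :> R.
  rewrite -natrM -cardsX -sum1_card natr_sum [RHS]big_mkcond.
  by apply: eq_bigr => -[g i] _; rewrite !inE /=; case: (_ && _).
have card_maps : (#|blowup| ^ #|B|)%:R =
    K%:R * (#|[set g : {ffun A -> H} | respects_parts g]%SET|%:R *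
    (#|T| ^ #|B|)%:R) :> R.
  transitivity (\sum_(f : {ffun B -> blowup}) (1 : R)).
    by rewrite sumr_const card_ffun.
  rewrite (sum_proj (fun=> 1)) -card_ffun -cardsT -sum_split; congr (_ * _).
  by apply: eq_bigr => p _; rewrite mulr1 andbT.
(* If [K] vanished, [card_maps] would leave no map at all from [B] to the non-empty [blowup]. *)
have K0 : K%:R != 0 :> R.
  apply/eqP => K0; move: card_maps; rewrite K0 mul0r; apply/eqP.
  by rewrite pnatr_eq0 -lt0n expn_gt0 vertex_gt0.
rewrite hom_densityE card_maps /bip_density /hom_density.
rewrite (eq_bigr (fun f => ((is_hom (proj f).1) && (is_hom (proj f).2))%:R));
  last by move=> f _; rewrite proj_hom.
rewrite (sum_proj (fun p => (is_hom p.1 && is_hom p.2)%:R)).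
rewrite -mulf_div divff// mul1r mulf_div -sum_split; congr (_ / _).
by apply: eq_bigr => p _; rewrite -natrM mulnb andbA.
Qed.

(** [P] restricts the first coordinate of the tail and [Q] the second coordinate of the head; the
    two remaining coordinates in [H] are free and give the factor in front. *)
Lemma cut_sum_blowup (R : realType) (q : R) (P Q : pred H) :
  cut_sum blowup blowup (@edge blowup) q
    (fun v => P (val v.1.1)) (fun w => Q (val w.1.2)) =
  (#|fst_part H| * #|snd_part H|)%:R *
  \sum_(x in fst_part H | P x) \sum_(y in snd_part H | Q y) \sum_i \sum_j
    ((edge x y && @edge T i j)%:R - q).
Proof.
have sumr (F : H -> T -> R) :
    \sum_(w : blowup | Q (val w.1.2)) F (val w.1.2) w.2 =
    #|fst_part H|%:R * \sum_(y in snd_part H | Q y) \sum_j F y j.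
  rewrite mulr_natl -(card_sig (mem (fst_part H))) -sumr_const big_sub_cond.
  rewrite !pair_big_dep /=; by apply: eq_bigl => w; rewrite ?andbT.
have suml (F : H -> T -> R) :
    \sum_(v : blowup | P (val v.1.1)) F (val v.1.1) v.2 =
    #|snd_part H|%:R * \sum_(x in fst_part H | P x) \sum_i F x i.
  rewrite mulr_natl -(card_sig (mem (snd_part H))) -sumr_const big_sub_cond.
  rewrite exchange_big !pair_big_dep /=.
  by apply: eq_bigl => w; rewrite ?andbT.
rewrite /cut_sum.
transitivity (\sum_(v : blowup | P (val v.1.1)) #|fst_part H|%:R *
    \sum_(y in snd_part H | Q y) \sum_j
      ((edge (val v.1.1) y && edge v.2 j)%:R - q)).
  apply: eq_bigr => v _.
  exact: (sumr (fun y j => (edge (val v.1.1) y && edge v.2 j)%:R - q)).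
rewrite (suml (fun x i => #|fst_part H|%:R *
  \sum_(y in snd_part H | Q y) \sum_j ((edge x y && edge i j)%:R - q))).
rewrite mulnC natrM -mulrA; congr (_ * _); rewrite mulr_sumr.
by apply: eq_bigr => x _; rewrite -mulr_sumr exchange_big.
Qed.
Lemma cut_sum_blowupE (R : realType) (p q : R) (P Q : pred H) :
  let t := hom_density R dK2 T in
  cut_sum blowup blowup (@edge blowup) q
    (fun v => P (val v.1.1)) (fun w => Q (val w.1.2)) =
  (#|fst_part H| * #|snd_part H| * #|T| ^ 2)%:R *
  (t * cut_sum (fst_part H) (snd_part H) (@edge H) p P Q +
   \sum_(x in fst_part H | P x) \sum_(y in snd_part H | Q y) (p * t - q)).
Proof.
move=> t; rewrite cut_sum_blowup [X in _ = X * _]natrM -[RHS]mulrA; congr (_ * _).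
rewrite /cut_sum mulr_sumr -big_split mulr_sumr; apply: eq_bigr => x _ /=.
rewrite mulr_sumr -big_split mulr_sumr; apply: eq_bigr => y _ /=.
have T0 : (#|T| ^ 2)%:R != 0 :> R.
  by rewrite pnatr_eq0 -lt0n expn_gt0 vertex_gt0.
(* Averaging over [T] turns each edge of [H] into weight [t]; the deviation from [q] splits into [t]
   times the deviation from [p] and the constant error [p * t - q]. *)
have -> : t * ((edge x y)%:R - p) + (p * t - q) = (edge x y)%:R * t - q by ring.
rewrite mulrBr mulrCA /t hom_density_dK2 [_ * (_ / _)]mulrC divfK// mulr_sumr.
have -> : (#|T| ^ 2)%:R * q = \sum_(i : T) \sum_(j : T) q.
  by rewrite !sumr_const -mulrnA mulr_natl.
rewrite -sumrB; apply: eq_bigr => i _; rewrite mulr_sumr -sumrB.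
by apply: eq_bigr => j _; rewrite -natrM mulnb.
Qed.

(** With [N] the product of the part sizes, the main term and the total error give
    [t * |X| <= 2 * delta * N]; dividing by [t >= 1/4] produces the constant [8]. *)
Lemma cut_sum_blowup_bound (R : realType) (p q delta : R) (P Q : pred H) :
  let t := hom_density R dK2 T in
  4^-1 <= t -> `|p * t - q| <= delta ->
  `|cut_sum blowup blowup (@edge blowup) q
     (fun v => P (val v.1.1)) (fun w => Q (val w.1.2))| <=
    delta * (#|blowup| * #|blowup|)%:R ->
  `|cut_sum (fst_part H) (snd_part H) (@edge H) p P Q| <=
    8 * delta * (#|fst_part H| * #|snd_part H|)%:R.
Proof.
move=> t t4 ptq; rewrite (cut_sum_blowupE p) -/t.
set X := cut_sum _ _ _ _ _ _; set Y := \sum_(x in _ | _) _.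
rewrite card_blowup; set n := #|fst_part H|; set m := #|snd_part H|.
set N : R := (n * m)%:R.
have N0 : 0 < N.
  by move: H0; rewrite /nonempty_parts -!card_gt0 ltr0n muln_gt0.
have T0 : 0 < (#|T| ^ 2)%:R :> R by rewrite ltr0n expn_gt0 vertex_gt0.
have -> : delta * (n * m * #|T| * (n * m * #|T|))%:R =
    (n * m * #|T| ^ 2)%:R * (delta * N).
  by rewrite !natrM /N natrM; ring.
rewrite normrM normr_nat ler_pM2l; last by rewrite natrM mulr_gt0.
have YN : `|Y| <= delta * N.
  have d0 : 0 <= delta by apply: le_trans ptq.
  apply: le_trans (ler_norm_sum _ _ _) _.
  apply: (@le_trans _ _ (\sum_(x in fst_part H) delta * m%:R)); last first.
    by rewrite sumr_const -(mulr_natr (delta * m%:R)) -mulrA -natrM mulnC.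
  rewrite big_mkcondr /=; apply: ler_sum => x _.
  case: ifP => _; last by rewrite mulr_ge0.
  apply: le_trans (ler_norm_sum _ _ _) _.
  apply: (@le_trans _ _ (\sum_(y in snd_part H) delta)); last first.
    by rewrite sumr_const mulr_natr.
  by rewrite big_mkcondr /=; apply: ler_sum => y _; case: ifP.
move=> XYN; have tX : t * `|X| <= 2 * delta * N.
  rewrite -[t]ger0_norm ?hom_density_ge0// -normrM -[t * X](addrK Y).
  by apply: le_trans (ler_normB _ _) _; lra.
have : 4^-1 * `|X| <= t * `|X| by rewrite ler_wpM2r.
lra.
Qed.

End Blowup.

(** * Equivalence of the forcing properties *)

Lemma quasirandom_digraphP (R : realType) (q : R) (G : nat -> digraph) :
  quasirandom q (fun n => digraphon R (G n)) <->
  forall eps, 0 < eps -> \forall n \near \oo, forall P Q,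
    `|cut_sum (G n) (G n) (@edge (G n)) q P Q| <= eps * (#|G n| * #|G n|)%:R.
Proof.
exact: (@quasirandomP R q (fun n => vertex (G n)) (fun n => vertex (G n))
  (fun n => vertex (G n)) (fun n => @edge (G n))
  (fun n => vertex_gt0 (G n)) (fun n => vertex_gt0 (G n))).
Qed.

Lemma quasirandom_bigraphP (R : realType) (q : R) (H : nat -> bigraph) :
  (forall n, nonempty_parts (H n)) ->
  quasirandom q (fun n => bigraphon R (H n)) <->
  forall eps, 0 < eps -> \forall n \near \oo, forall P Q,
    `|cut_sum (fst_part (H n)) (snd_part (H n)) (@edge (H n)) q P Q| <=
    eps * (#|fst_part (H n)| * #|snd_part (H n)|)%:R.
Proof.
move=> H0; have fst0 n : (0 < #|fst_part (H n)|)%N.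
  by rewrite card_gt0; case/andP: (H0 n).
have snd0 n : (0 < #|snd_part (H n)|)%N.
  by rewrite card_gt0; case/andP: (H0 n).
exact: (@quasirandomP R q (fun n => vertex (H n))
  (fun n => mem (fst_part (H n)))
  (fun n => mem (snd_part (H n))) (fun n => @edge (H n)) fst0 snd0).
Qed.

Lemma asymmetric_forcing_directed (R : realType) (B : ograph) (h : B -> dK2)
    (hP : is_hom h) :
  asymmetric_forcing R (under_bigraph hP) -> directed_forcing R B.
Proof.
move=> forcing p G /andP[p0 p1] GK GB.
have bipE (D : ograph) (g : D -> dK2) (gP : is_hom g) :
    (fun n => bip_density R (under_bigraph gP) (double_cover (G n))) =
    (fun n => hom_density R D (G n)).
  by apply/funext => n; rewrite bip_density_double_cover.
have : quasirandom (p / 2) (fun n => bigraphon R (double_cover (G n))).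
  (* The asymmetric property is applied with bipartite density [p / 2], which again lies in
     [[0, 1]]. *)
  apply: forcing; first by apply/andP; split; lra.
  - by move=> n; exact: double_cover_nonempty_parts.
  - by rewrite bipE.
  - by rewrite bipE num_sedges_under.
move=> /(quasirandom_bigraphP _ (fun n => double_cover_nonempty_parts (G n))) cut.
apply/quasirandom_digraphP => eps eps0.
apply: filterS (cut eps eps0) => n cutn P Q.
rewrite cut_sum_double_cover; apply: le_trans (cutn _ _) _.
by rewrite card_double_cover_fst card_double_cover_snd.
Qed.

Lemma directed_forcing_asymmetric (R : realType) (B : ograph) (h : B -> dK2)
    (hP : is_hom h) :
  directed_forcing R B -> asymmetric_forcing R (under_bigraph hP).
Proof.
move=> forcing p H p01 H0 HK HB; rewrite num_sedges_under in HB.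
have [T [TK TB]] := exists_quasirandom_tournaments R B.
pose G n := blowup (T n) (H0 n).
have GE (D : ograph) (g : D -> dK2) (gP : is_hom g) :
    (fun n => hom_density R D (G n)) =
    (fun n => bip_density R (under_bigraph gP) (H n) * hom_density R D (T n)).
  by apply/funext => n; rewrite (hom_density_blowup _ _ _ gP).
have : quasirandom (p / 2) (fun n => digraphon R (G n)).
  (* The limits are products: [p * 1/2] for edges, and [p^e * 2^-e = (p / 2)^e] for [B]. *)
  apply: forcing => //.
    by rewrite (GE dK2 id (id_hom dK2)); exact: cvgM.
  by rewrite (GE B h hP) exprMn; exact: cvgM.
move=> /quasirandom_digraphP cut; apply/(quasirandom_bigraphP _ H0) => eps eps0.
(* Compensates for the factor [8] lost in [cut_sum_blowup_bound]. *)
have d0 : 0 < eps / 8 by rewrite divr_gt0.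
have pT : (p * hom_density R dK2 (T n) - p / 2) @[n --> \oo] --> (0 : R).
  have h0 : _ --> (p * 2^-1 - p / 2 : R) :=
    cvgB (cvgM (cvg_cst p) TK) (cvg_cst (p / 2)).
  by rewrite subrr in h0; exact: h0.
near=> n => P Q; rewrite (_ : eps = 8 * (eps / 8)); last by field.
apply: (@cut_sum_blowup_bound _ (T n) (H0 n) _ _ (p / 2)).
(* An edge density within [1/4] of [1/2] is at least [1/4], as the bound requires. *)
- have : `|2^-1 - hom_density R dK2 (T n)| <= 4^-1.
    near: n; move/cvgrPdist_le: TK; apply; rewrite invr_gt0//.
  by rewrite ler_norml => /andP[_]; lra.
- rewrite -normrN -sub0r; near: n; move/cvgrPdist_le: pT; exact.
- by have := near (cut _ d0) n; apply.
Unshelve. all: by end_near. Qed.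

Theorem theorem1p8 (R : realType) (B : ograph) (h : B -> dK2) (hP : is_hom h) :
  asymmetric_forcing R (under_bigraph hP) <-> directed_forcing R B.
Proof.
split; [exact: asymmetric_forcing_directed|exact: directed_forcing_asymmetric].
Qed.
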